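(* Let $a,b>0$ be real numbers and $\lambda\in[0,1]$. Then the following inequalities hold. (i) (Ratio-type reverse inequality) $$a^{1-\lambda}b^{\lambda}\leq(1-\lambda)a+\lambda b\leq a^{1-\lambda}b^{\lambda}\exp\left\{\frac{\lambda(1-\lambda)(a-b)^2}{d_1^2}\right\},$$ where $d_1=\min\{a,b\}$. (ii) (Difference-type reverse inequality) $$a^{1-\lambda}b^{\lambda}\leq(1-\lambda)a+\lambda b\leq a^{1-\lambda}b^{\lambda}+\lambda(1-\lambda)\left\{\log\left(\frac{a}{b}\right)\right\}^2d_2,$$ where $d_2=\max\{a,b\}$.
   Context: Here $\log$ denotes the natural logarithm. *)

(* Defs.v *)
From Stdlib Require Export Reals.

(* Main.v *)
Require Import Defs.
From Stdlib Require Import Reals.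
From Stdlib Require Import Lra.
From Coquelicot Require Rcomplements.
Open Scope R_scope.

(** Every bound is a convex combination, with weights [1 - lambda] and
    [lambda], of tangent-line inequalities.  For the lower bound, the tangent
    of [exp] at [g = (1 - lambda) ln a + lambda ln b] is compared with [exp] at
    [ln a] and [ln b].  For the difference bound, the tangents at [ln a] and
    [ln b] are evaluated at [g], which leaves
    [lambda (1 - lambda) (ln a - ln b) (a - b)].  For the ratio bound, the
    tangents of [ln] at [a] and [b] are evaluated at the arithmetic mean, which
    leaves [lambda (1 - lambda) (a - b)^2 / (a b)]. *)

Lemma exp_tangent_le (u v : R) : exp v * (1 + (u - v)) <= exp u.
Proof.
  replace (exp u) with (exp v * exp (u - v))
    by (rewrite <- exp_plus; f_equal; ring).
  apply Rmult_le_compat_l; [left; apply exp_pos | apply exp_ineq1_le].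
Qed.

Lemma exp_le_compat (u v : R) : u <= v -> exp u <= exp v.
Proof.
  intros [h | ->]; [left; apply exp_increasing; assumption | apply Rle_refl].
Qed.

(** The tangent of [exp] at [ln t], evaluated at [ln s] and divided by [t]. *)
Lemma ln_tangent_le (s t : R) : 0 < s -> 0 < t -> ln s <= ln t + (s - t) / t.
Proof.
  intros hs ht.
  pose proof (exp_tangent_le (ln s) (ln t)) as h.
  rewrite !exp_ln in h by assumption.
  apply Rmult_le_reg_l with t; [assumption |].
  replace (t * (ln t + (s - t) / t)) with (t * ln t + (s - t)) by (field; lra).
  lra.
Qed.

Lemma Rpower_mul_Rpower (a b p q : R) :
  Rpower a p * Rpower b q = exp (p * ln a + q * ln b).
Proof. unfold Rpower; symmetry; apply exp_plus. Qed.

Lemma weighted_am_gm (a b lambda : R) : 0 < a -> 0 < b -> 0 <= lambda <= 1 ->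
  Rpower a (1 - lambda) * Rpower b lambda <= (1 - lambda) * a + lambda * b.
Proof.
  intros ha hb hl; rewrite Rpower_mul_Rpower.
  set (g := (1 - lambda) * ln a + lambda * ln b).
  pose proof (exp_tangent_le (ln a) g) as h1.
  pose proof (exp_tangent_le (ln b) g) as h2.
  rewrite exp_ln in h1, h2 by assumption.
  apply (Rmult_le_compat_l (1 - lambda)) in h1; [| lra].
  apply (Rmult_le_compat_l lambda) in h2; [| lra].
  (* The first-order terms cancel because [g] is the weighted mean of [ln a] and [ln b]. Only the
     occurrences of [g] outside [exp] are unfolded, so [exp g] stays an atom for [ring]. *)
  replace (exp g) with
    ((1 - lambda) * (exp g * (1 + (ln a - g)))
     + lambda * (exp g * (1 + (ln b - g)))) by (unfold g at 2 4; ring).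
  lra.
Qed.

(** Used to pass from the denominator [a * b], which is minimum times maximum, to [d1 ^ 2]. *)
Lemma Rmin_sqr_le_mul (a b : R) : 0 < a -> 0 < b -> Rmin a b ^ 2 <= a * b.
Proof. intros ha hb; unfold Rmin; destruct (Rle_dec a b); nra. Qed.

Lemma weighted_am_gm_ratio (a b lambda : R) :
  0 < a -> 0 < b -> 0 <= lambda <= 1 ->
  (1 - lambda) * a + lambda * b <=
    Rpower a (1 - lambda) * Rpower b lambda
    * exp (lambda * (1 - lambda) * (a - b) ^ 2 / Rmin a b ^ 2).
Proof.
  intros ha hb hl; rewrite Rpower_mul_Rpower, <- exp_plus.
  set (m := (1 - lambda) * a + lambda * b).
  assert (hm : 0 < m) by (unfold m; nra).
  rewrite <- (exp_ln m) by assumption.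
  apply exp_le_compat.
  pose proof (ln_tangent_le m a hm ha) as h1.
  pose proof (ln_tangent_le m b hm hb) as h2.
  apply (Rmult_le_compat_l (1 - lambda)) in h1; [| lra].
  apply (Rmult_le_compat_l lambda) in h2; [| lra].
  (* Here [m - a = lambda * (b - a)] and [m - b = (1 - lambda) * (a - b)]. *)
  assert (e : (1 - lambda) * ((m - a) / a) + lambda * ((m - b) / b)
              = lambda * (1 - lambda) * (a - b) ^ 2 / (a * b))
    by (unfold m; field; lra).
  assert (hd : lambda * (1 - lambda) * (a - b) ^ 2 / (a * b)
               <= lambda * (1 - lambda) * (a - b) ^ 2 / Rmin a b ^ 2).
  { apply Rmult_le_compat_l.
    - apply Rmult_le_pos; [nra | apply pow2_ge_0].
    - apply Rinv_le_contravar; [| apply Rmin_sqr_le_mul; assumption].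
      apply pow_lt, Rmin_glb_lt; assumption. }
  lra.
Qed.

(** The tangent of [exp] at the larger logarithm has slope [Rmax a b], so the gap between [a] and
    [b] is at most [Rmax a b] times the gap between their logarithms. Both differences have the same
    sign. *)
Lemma ln_diff_mul_diff_le (a b : R) : 0 < a -> 0 < b ->
  (ln a - ln b) * (a - b) <= (ln a - ln b) ^ 2 * Rmax a b.
Proof.
  intros ha hb.
  pose proof (exp_tangent_le (ln b) (ln a)) as h1.
  pose proof (exp_tangent_le (ln a) (ln b)) as h2.
  rewrite !exp_ln in h1, h2 by assumption.
  unfold Rmax; destruct (Rle_dec a b) as [h | h].
  - assert (ln a <= ln b) by (apply Rcomplements.ln_le; assumption). nra.
  - assert (ln b <= ln a) by (apply Rcomplements.ln_le; lra). nra.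
Qed.

Lemma weighted_am_gm_difference (a b lambda : R) :
  0 < a -> 0 < b -> 0 <= lambda <= 1 ->
  (1 - lambda) * a + lambda * b <=
    Rpower a (1 - lambda) * Rpower b lambda
    + lambda * (1 - lambda) * ln (a / b) ^ 2 * Rmax a b.
Proof.
  intros ha hb hl; rewrite Rpower_mul_Rpower, Rcomplements.ln_div by assumption.
  set (g := (1 - lambda) * ln a + lambda * ln b).
  pose proof (exp_tangent_le g (ln a)) as h1.
  pose proof (exp_tangent_le g (ln b)) as h2.
  rewrite exp_ln in h1, h2 by assumption.
  apply (Rmult_le_compat_l (1 - lambda)) in h1; [| lra].
  apply (Rmult_le_compat_l lambda) in h2; [| lra].
  (* Here [g - ln a = lambda * (ln b - ln a)] and [g - ln b = (1 - lambda) * (ln a - ln b)]. *)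
  assert (e : (1 - lambda) * (a * (1 + (g - ln a)))
              + lambda * (b * (1 + (g - ln b)))
              = (1 - lambda) * a + lambda * b
                - lambda * (1 - lambda) * ((ln a - ln b) * (a - b)))
    by (unfold g; ring).
  assert (hw : 0 <= lambda * (1 - lambda)) by nra.
  pose proof (Rmult_le_compat_l _ _ _ hw (ln_diff_mul_diff_le a b ha hb)) as h3.
  lra.
Qed.

Theorem corollary2p2 (a b lambda : R) (ha : 0 < a) (hb : 0 < b)
  (hlambda : 0 <= lambda <= 1) :
  (let d1 := Rmin a b in
   Rpower a (1 - lambda) * Rpower b lambda <= (1 - lambda) * a + lambda * b
     <= Rpower a (1 - lambda) * Rpower b lambda
        * exp (lambda * (1 - lambda) * (a - b) ^ 2 / d1 ^ 2))
  /\
  (let d2 := Rmax a b in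
   Rpower a (1 - lambda) * Rpower b lambda <= (1 - lambda) * a + lambda * b
     <= Rpower a (1 - lambda) * Rpower b lambda
        + lambda * (1 - lambda) * (ln (a / b)) ^ 2 * d2).
Proof.
  repeat split.
  - apply weighted_am_gm; assumption.
  - apply weighted_am_gm_ratio; assumption.
  - apply weighted_am_gm; assumption.
  - apply weighted_am_gm_difference; assumption.
Qed.
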